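(* Let $\mathcal{A}$ be a free arrangement in $V=\mathbb{K}^\ell$, let $H\in\mathcal{A}$ and $\mathcal{A}':=\mathcal{A}\setminus\{H\}$. Then (1) the projective dimension satisfies $\mathrm{pd}_S\,D(\mathcal{A}')\le1$; and (2) $D(\mathcal{A}')$ is generated as an $S$-module by at most $\ell+1$ derivations.
   Context: Let $\mathbb{K}$ be a field, $V=\mathbb{K}^\ell$, $S=\mathrm{Sym}^*(V^* )=\mathbb{K}[x_1,\ldots,x_\ell]$ and $\mathrm{Der}\,S=\bigoplus_{i=1}^\ell S\partial_{x_i}$. An arrangement $\mathcal{A}$ in $V$ is a finite set of linear hyperplanes in $V$; arrangements are assumed essential ($\bigcap_{H\in\mathcal{A}}H=\{0\}$) unless otherwise specified. For $H\in\mathcal{A}$ fix $\alpha_H\in V^*$ with $\ker\alpha_H=H$. The logarithmic derivation module is $D(\mathcal{A}):=\{\theta\in\mathrm{Der}\,S\mid\theta(\alpha_H)\in S\alpha_H\ (\forall H\in\mathcal{A})\}$, and $\mathcal{A}$ is free if $D(\mathcal{A})$ is a free $S$-module (with a homogeneous basis). *)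

(* Defs.v *)
From HB Require Import structures.
From mathcomp Require Import all_boot all_order all_algebra finmap.
From mathcomp Require Import boolp.
From mathcomp Require Import mpoly.

Set Implicit Arguments.
Unset Strict Implicit.
Unset Printing Implicit Defensive.

Import GRing.Theory.
Local Open Scope ring_scope.

Section Modules.
Context {R : nzRingType}.

Definition is_basis (M : lmodType R) (I : choiceType) (b : I -> M) : Prop :=
  (forall m, exists (s : seq I) (c : I -> R), m = \sum_(i <- s) c i *: b i) /\
  (forall (s : seq I) (c : I -> R), uniq s ->
     \sum_(i <- s) c i *: b i = 0 -> forall i, i \in s -> c i = 0).

Definition generated_by_at_most (M : lmodType R) (k : nat) : Prop :=
  exists n (g : 'I_n -> M), (n <= k)%N /\
    forall m, exists c : 'I_n -> R, m = \sum_(i < n) c i *: g i.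

Definition surjective_map (T U : Type) (f : T -> U) : Prop :=
  forall y, exists x, f x = y.

Definition projective (P : lmodType R) : Prop :=
  forall (M N : lmodType R) (g : {linear M -> N}) (f : {linear P -> N}),
    surjective_map g -> exists h : {linear P -> M}, forall x, g (h x) = f x.

(* M has a projective resolution
     ... -> P 2 -> P 1 -> P 0 -> M -> 0  with P i = 0 for all i > n. *)
Definition pd_le (M : lmodType R) (n : nat) : Prop :=
  exists (P : nat -> lmodType R) (d : forall i, {linear P i.+1 -> P i})
         (e : {linear P 0%N -> M}),
    [/\ forall i, projective (P i),
        surjective_map e,
        forall x, e x = 0 <-> exists y, d 0%N y = x,
        forall i x, d i x = 0 <-> exists y, d i.+1 y = x
      & forall i, (n < i)%N -> forall x : P i, x = 0].

End Modules.

Section Arrangements.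
Context {K : fieldType} {l : nat}.

Notation V := 'rV[K]_l.
Notation S := {mpoly K[l]}.
Implicit Types (A : {fset {vspace V}}) (alpha : {vspace V} -> 'Hom(V, K^o)).

Definition arrangement A : Prop :=
  forall H, H \in A -> (\dim H).+1 = l.

Definition essential A : Prop :=
  (\bigcap_(H <- A) H)%VS = 0%VS.

(* alpha picks, for each H in A, a linear form with kernel H. *)
Definition defining_forms A alpha : Prop :=
  forall H, H \in A -> lker (alpha H) = H.

(* The image of a linear form under V^* -> Sym V^* = K[x_1, ..., x_l],
   where x_i is the i-th coordinate function. *)
Definition poly_of_form (a : 'Hom(V, K^o)) : S :=
  \sum_(i < l) a (delta_mx 0 i) *: 'X_i.

(* theta : 'rV[S]_l stands for the derivation \sum_i theta_i d/dx_i. *)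
Definition der_app (theta : 'rV[S]_l) (f : S) : S :=
  \sum_(i < l) theta 0 i * f^`M(i).

Definition der_homog (theta : 'rV[S]_l) : Prop :=
  exists d : nat, forall i, theta 0 i \is d.-homog.

Definition logder_pred A alpha : {pred 'rV[S]_l} :=
  fun theta => `[< forall H, H \in A ->
    exists g : S, der_app theta (poly_of_form (alpha H))
                  = g * poly_of_form (alpha H) >].

Fact logder_submod_closed A alpha : submod_closed (logder_pred A alpha).
Proof.
split.
  apply/asboolP => H _; exists 0; rewrite mul0r /der_app big1 // => i _.
  by rewrite mxE mul0r.
move=> a u v /asboolP hu /asboolP hv; apply/asboolP => H HA.
have [g eg] := hu H HA; have [h eh] := hv H HA; exists (a * g + h).
rewrite mulrDl -mulrA -eg -eh /der_app mulr_sumr -big_split /=.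
by apply: eq_bigr => i _; rewrite !mxE mulrDl mulrA.
Qed.

HB.instance Definition _ A alpha :=
  GRing.isSubmodClosed.Build _ _ (logder_pred A alpha)
    (logder_submod_closed A alpha).

Record logder A alpha := LogDer {
  logder_val : 'rV[S]_l;
  _ : logder_val \in logder_pred A alpha }.

HB.instance Definition _ A alpha := [isSub for @logder_val A alpha].
HB.instance Definition _ A alpha := [Choice of logder A alpha by <:].
HB.instance Definition _ A alpha :=
  [SubChoice_isSubLmodule of logder A alpha by <:].

Definition free_arrangement A alpha : Prop :=
  exists (I : choiceType) (b : I -> logder A alpha),
    is_basis b /\ forall i, der_homog (logder_val (b i)).

End Arrangements.

(* Main.v *)
(** Write a for the linear form of H and S for the polynomial ring.  Since
    a D(A') is contained in D(A), the theorem amounts to: the ideal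
    I = (a) + { theta(a) | theta in D(A') } is principal modulo a.  Then
    D(A') = D(A) + S phi, with at most l + 1 generators, and the only relation
    comes from writing a phi in the basis of D(A).

    Freeness of D(A) enters through a reflexivity property of I: if p x and q x
    are in I with p, q coprime modulo a, then x is in I.  Indeed, if u and v
    witness p x and q x, then q u - p v is in D(A); comparing coordinates of a u
    and a v on the basis, coprimality produces psi in D(A') with u = p psi and
    v = q psi modulo D(A).  As I contains the product of the linear forms of A',
    a minimal sub-product in I then generates I modulo a. *)

From HB Require Import structures.
Require Import Defs.
From mathcomp Require Import all_boot all_order all_algebra finmap.
From mathcomp Require Import boolp.
From mathcomp Require Import mpoly.
From mathcomp Require Import ring.

Set Implicit Arguments.
Unset Strict Implicit.
Unset Printing Implicit Defensive.

Import GRing.Theory.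
Local Open Scope fset_scope.
Local Open Scope ring_scope.

(** * Linear forms as primes, and divisibility modulo one of them *)

Definition rdvd (R : nzRingType) (p x : R) : Prop := exists g, x = g * p.

Section LinearForms.
Context {K : fieldType} {l : nat}.
Notation V := 'rV[K]_l.
Notation S := {mpoly K[l]}.
Notation form := ('Hom(V, K^o)).
Implicit Types (a b : form) (v : V) (f g p q x y : S).
Notation lin := (@poly_of_form K l).

Lemma poly_of_formZ t a : lin (t *: a) = t *: lin a.
Proof.
by rewrite /poly_of_form scaler_sumr; apply: eq_bigr => i _; rewrite scale_lfunE scalerA.
Qed.

Lemma poly_of_formB a b : lin (a - b) = lin a - lin b.
Proof.
rewrite /poly_of_form -sumrB; apply: eq_bigr => i _.
by rewrite add_lfunE opp_lfunE scalerBl.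
Qed.

Lemma lfun_coord a v : a v = \sum_(i < l) v 0 i * a (delta_mx 0 i).
Proof.
rewrite {1}(row_sum_delta v) linear_sum; apply: eq_bigr => i _.
by rewrite linearZ.
Qed.

Lemma poly_of_form0 : lin 0 = 0.
Proof. by rewrite -(subrr (0 : form)) poly_of_formB subrr. Qed.

Lemma poly_of_form_eq0 a : lin a = 0 -> a = 0.
Proof.
move=> a0; apply/lfunP => v; rewrite lfun_coord zero_lfunE big1 // => j _.
have := congr1 (mcoeff U_(j)%MM) a0.
rewrite mcoeff0 /poly_of_form linear_sum (bigD1 j) //= mcoeffZ mcoeffXU eqxx mulr1.
rewrite big1 ?addr0 => [->|i /negPf ne]; first by rewrite mulr0.
by rewrite mcoeffZ mcoeffXU ne mulr0.
Qed.

Lemma form_normalized a : a <> 0 -> exists v, a v = 1.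
Proof.
move=> a0; have [v av0] : exists v, a v <> 0.
  apply: contrapT => h; apply: a0; apply/lfunP => v; rewrite zero_lfunE.
  by apply: contrapT => av; apply: h; exists v.
exists ((a v)^-1 *: v); rewrite linearZ /=; apply: mulVf; exact/eqP.
Qed.

(* The comorphism of the projection w |-> w - a(w) v of V onto ker a, when a v = 1. *)
Definition proj_form a v : S -> S :=
  comp_mpoly [tuple 'X_i - v 0 i *: lin a | i < l].

HB.instance Definition _ a v := GRing.RMorphism.on (proj_form a v).
HB.instance Definition _ a v := GRing.Linear.on (proj_form a v).

Lemma proj_formX a v i : proj_form a v 'X_i = 'X_i - v 0 i *: lin a.
Proof. by rewrite /proj_form comp_mpolyXU -tnth_nth tnth_mktuple. Qed.

Lemma proj_formE a v b : proj_form a v (lin b) = lin (b - b v *: a).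
Proof.
rewrite poly_of_formB poly_of_formZ [b v]lfun_coord scaler_suml.
rewrite {1 2}/poly_of_form linear_sum -sumrB; apply: eq_bigr => i _.
by rewrite linearZ /= proj_formX scalerBr scalerA mulrC.
Qed.

(** Each ['X_i] moves by a multiple of [lin a], and [proj_form a v] is a ring morphism, so the
    congruence spreads to products and sums. *)
Lemma proj_form_sub a v f : rdvd (lin a) (f - proj_form a v f).
Proof.
have dD x y : rdvd (lin a) x -> rdvd (lin a) y -> rdvd (lin a) (x + y).
  by move=> [g ->] [h ->]; exists (g + h); rewrite mulrDl.
elim/mpolyind: f => [|c m f _ _ IH]; first by exists 0; rewrite raddf0 subrr mul0r.
rewrite raddfD opprD addrACA; apply: dD => //.
rewrite [X in _ - X]linearZ /= -scalerBr.
suff [g ->] : rdvd (lin a) ('X_[m] - proj_form a v 'X_[m]).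
  by exists (c *: g); rewrite scalerAl.
have dM x y : rdvd (lin a) (x - proj_form a v x) -> rdvd (lin a) (y - proj_form a v y) ->
    rdvd (lin a) (x * y - proj_form a v (x * y)).
  move=> [g eg] [h eh]; rewrite rmorphM.
  exists (g * y + h * proj_form a v x).
  by rewrite mulrDl mulrAC -eg [h * _ * _]mulrAC -eh; ring.
rewrite mpolyXE_id; elim/big_ind: _ => [|x y|i _].
- by exists 0; rewrite rmorph1 subrr mul0r.
- exact: dM.
elim: (m i) => [|k IHk]; first by exists 0; rewrite expr0 rmorph1 subrr mul0r.
rewrite exprS; apply: dM => //; rewrite proj_formX; exists (v 0 i)%:MP.
by rewrite mul_mpolyC; ring.
Qed.

(** This embeds S/(a) into the domain S, so that congruences modulo a become equations between
    polynomials. *)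
Lemma proj_form_eq0 a v f : a v = 1 -> proj_form a v f = 0 <-> rdvd (lin a) f.
Proof.
move=> av1; split=> [f0|[g ->]].
  by have := proj_form_sub a v f; rewrite f0 subr0.
by rewrite rmorphM /= proj_formE av1 scale1r subrr poly_of_form0 mulr0.
Qed.

Lemma form_prime a f g : a <> 0 -> rdvd (lin a) (f * g) -> rdvd (lin a) f \/ rdvd (lin a) g.
Proof.
move=> /form_normalized[v av1] /(proj_form_eq0 _ av1)/eqP.
rewrite rmorphM mulf_eq0 => /orP[]/eqP /(proj_form_eq0 _ av1); by [left|right].
Qed.

Lemma form_dvd a b : a <> 0 -> rdvd (lin a) (lin b) -> exists t, b = t *: a.
Proof.
move=> /form_normalized[v av1] /(proj_form_eq0 _ av1).
rewrite proj_formE => /poly_of_form_eq0/subr0_eq.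
by exists (b v).
Qed.

(** Divisibility of x by p in the quotient ring S/(a). *)
Definition dvdmod a p x : Prop := exists g, rdvd (lin a) (x - g * p).

(** Projection along v turns divisibility by b modulo a into plain divisibility by the linear form
    [b'], which is nonzero because a does not divide b; then [form_prime] applies. *)
Lemma dvdmod_prime a b f g : a <> 0 -> ~ rdvd (lin a) (lin b) ->
  dvdmod a (lin b) (f * g) -> dvdmod a (lin b) f \/ dvdmod a (lin b) g.
Proof.
move=> a0; have [v av1] := form_normalized a0; pose b' := b - b v *: a.
have E x : dvdmod a (lin b) x <-> rdvd (lin b') (proj_form a v x).
  rewrite /b'; split=> [[h /(proj_form_eq0 _ av1)]|[h]].
    rewrite rmorphB rmorphM /= proj_formE => /subr0_eq ->.
    by exists (proj_form a v h).
  rewrite poly_of_formB poly_of_formZ => eh; exists h.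
  have [k ek] := proj_form_sub a v x; exists (k - h * (b v)%:MP).
  rewrite (_ : x - _ = (x - proj_form a v x) + (proj_form a v x - h * lin b)); last by ring.
  by rewrite ek eh -mul_mpolyC; ring.
rewrite !E rmorphM => nab; apply: form_prime => b'0; apply: nab.
by apply/(proj_form_eq0 _ av1); rewrite proj_formE -/b' b'0 poly_of_form0.
Qed.

End LinearForms.

(** * Elementary rules for divisibility and for scaling row vectors *)

Lemma rdvdD (R : nzRingType) (p x y : R) : rdvd p x -> rdvd p y -> rdvd p (x + y).
Proof. by move=> [g ->] [h ->]; exists (g + h); rewrite mulrDl. Qed.

Lemma rdvdMl (R : nzRingType) (p c x : R) : rdvd p x -> rdvd p (c * x).
Proof. by move=> [g ->]; exists (c * g); rewrite mulrA. Qed.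

Lemma rdvdN (R : nzRingType) (p x : R) : rdvd p x -> rdvd p (- x).
Proof. by move=> [g ->]; exists (- g); rewrite mulNr. Qed.

Lemma rdvdB (R : nzRingType) (p x y : R) : rdvd p x -> rdvd p y -> rdvd p (x - y).
Proof. by move=> px /rdvdN; apply: rdvdD. Qed.

Lemma scale_rV_eq0 (R : idomainType) (n : nat) (c : R) (u : 'rV[R]_n) :
  c *: u = 0 -> c = 0 \/ u = 0.
Proof.
move=> cu; have [->|c0] := eqVneq c 0; [by left|right; apply/rowP => j].
have /rowP/(_ j)/eqP := cu; rewrite !mxE mulf_eq0 (negPf c0) => /eqP; exact.
Qed.

Lemma scale_rVI (R : idomainType) (n : nat) (c : R) : c <> 0 ->
  injective (fun u : 'rV[R]_n => c *: u).
Proof.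
move=> c0 u v /= /eqP; rewrite -subr_eq0 -scalerBr => /eqP/scale_rV_eq0[//|].
exact: subr0_eq.
Qed.

(** * Logarithmic derivations and the deletion of one hyperplane *)

Section Logder.
Context {K : fieldType} {l : nat}.
Notation V := 'rV[K]_l.
Notation S := {mpoly K[l]}.
Notation form := ('Hom(V, K^o)).
Notation lin := (@poly_of_form K l).
Implicit Types (A : {fset {vspace V}}) (alpha : {vspace V} -> form) (H : {vspace V}).

Lemma der_appD (u v : 'rV[S]_l) (f : S) : der_app (u + v) f = der_app u f + der_app v f.
Proof. by rewrite /der_app -big_split; apply: eq_bigr => i _; rewrite mxE mulrDl. Qed.

Lemma der_appZ (c : S) (u : 'rV[S]_l) (f : S) : der_app (c *: u) f = c * der_app u f.
Proof. by rewrite /der_app mulr_sumr; apply: eq_bigr => i _; rewrite mxE mulrA. Qed.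

Lemma der_appB (u v : 'rV[S]_l) (f : S) : der_app (u - v) f = der_app u f - der_app v f.
Proof. by rewrite der_appD -scaleN1r der_appZ mulN1r. Qed.

Lemma der_app_const (v : V) (a : form) :
  der_app (map_mx (@mpolyC l K) v) (lin a) = (a v)%:MP.
Proof.
rewrite lfun_coord raddf_sum /der_app; apply: eq_bigr => i _.
rewrite mxE; transitivity ((v 0 i)%:MP * (a (delta_mx 0 i))%:MP : S); last exact/esym/mpolyCM.
congr (_ * _).
rewrite /poly_of_form raddf_sum (bigD1 i) //= mderivZ mderivX mnm1E eqxx.
rewrite big1 ?addr0 => [|j /negPf ne].
  rewrite (_ : (_ - _)%MM = 0%MM); last by apply/mnmP => k; rewrite mnmBE subnn mnm0E.
  by rewrite mpolyX0 scale1r alg_mpolyC.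
by rewrite mderivZ mderivX mnm1E ne scale0r scaler0.
Qed.

Lemma logderP A alpha (u : 'rV[S]_l) : u \in logder_pred A alpha <->
  forall H, H \in A -> rdvd (lin (alpha H)) (der_app u (lin (alpha H))).
Proof. by split=> [/asboolP|h]; [|apply/asboolP]. Qed.

Context (A : {fset {vspace V}}) (alpha : {vspace V} -> form) (H : {vspace V}).
Hypotheses (arrA : arrangement A) (defA : defining_forms A alpha) (HA : H \in A).
Notation D := (logder_pred A alpha).
Notation D' := (logder_pred (A `\ H) alpha).
Notation a := (alpha H).

Lemma alpha_neq0 X : X \in A -> alpha X <> 0.
Proof.
move=> XA a0; have := arrA XA; rewrite -(defA XA) a0.
have -> : lker (0 : form) = fullv.
  apply/eqP; rewrite eqEsubv subvf; apply/subvP => v _.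
  by rewrite memv_ker zero_lfunE.
by rewrite dimvf dim_matrix mul1r => /esym/n_Sn.
Qed.

(** Divisibility would make the two forms proportional, hence their kernels nested and of the same
    dimension. *)
Lemma alpha_ndvd X Y : X \in A -> Y \in A -> X <> Y ->
  ~ rdvd (lin (alpha X)) (lin (alpha Y)).
Proof.
move=> XA YA ne /(form_dvd (alpha_neq0 XA))[t e]; apply: ne; apply/eqP.
have eXY : \dim X = \dim Y by apply: succn_inj; rewrite (arrA XA) (arrA YA).
rewrite eqEdim eXY leqnn andbT -(defA XA) -(defA YA) e.
by apply/subvP => v; rewrite !memv_ker scale_lfunE => /eqP ->; rewrite scaler0.
Qed.

Lemma logder_del u : u \in D' -> rdvd (lin a) (der_app u (lin a)) -> u \in D.
Proof.
move=> /logderP uD' ua; apply/logderP => X XA; have [->//|ne] := eqVneq X H.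
by apply: uD'; rewrite !inE ne.
Qed.

Lemma logder_sub u : u \in D -> u \in D'.
Proof. by move=> /logderP uD; apply/logderP => X; rewrite !inE => /andP[_]; apply: uD. Qed.

Lemma logder_mul u : u \in D' -> lin a *: u \in D.
Proof.
move=> uD'; apply: logder_del; first exact: rpredZ.
by rewrite der_appZ; exists (der_app u (lin a)); rewrite mulrC.
Qed.

(* x lies in the ideal { theta(alpha_H) : theta in D(A') } + (alpha_H) *)
Definition attained (x : S) : Prop :=
  exists2 u, u \in D' & rdvd (lin a) (der_app u (lin a) - x).

Lemma attainedM c x : attained x -> attained (c * x).
Proof.
move=> [u uD' ux]; exists (c *: u); first exact: rpredZ.
by rewrite der_appZ -mulrBr; apply: rdvdMl.
Qed.

Lemma attained_eqmod x y : attained x -> rdvd (lin a) (x - y) -> attained y.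
Proof.
move=> [u uD' ux] xy; exists u => //.
by rewrite -[der_app _ _](subrK x) -addrA; apply: rdvdD.
Qed.

Section FreeBasis.
Context (m : nat) (b : 'I_m -> 'rV[S]_l).
Hypothesis b_in : forall i, b i \in D.
Hypothesis b_gen : forall u, u \in D -> exists c : 'I_m -> S, u = \sum_(i < m) c i *: b i.
Hypothesis b_free : forall c : 'I_m -> S, \sum_(i < m) c i *: b i = 0 -> forall i, c i = 0.

Lemma sum_in_D c : \sum_(i < m) c i *: b i \in D.
Proof. by apply: rpred_sum => i _; apply: rpredZ. Qed.

Let sumB (c e : 'I_m -> S) :
  \sum_(i < m) c i *: b i - \sum_(i < m) e i *: b i = \sum_(i < m) (c i - e i) *: b i.
Proof. by rewrite -sumrB; apply: eq_bigr => i _; rewrite scalerBl. Qed.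

Let sumZ x (c : 'I_m -> S) :
  x *: \sum_(i < m) c i *: b i = \sum_(i < m) (x * c i) *: b i.
Proof. by rewrite scaler_sumr; apply: eq_bigr => i _; rewrite scalerA. Qed.

(** The reflexivity property, with p linear so that p is prime modulo a and coprimality just means
    that p does not divide q modulo a. *)
Lemma attained_coprime (p : form) q x :
  ~ rdvd (lin a) (lin p) -> ~ dvdmod a (lin p) q ->
  attained (lin p * x) -> attained (q * x) -> attained x.
Proof.
move=> nap npq [u uD' ux] [v vD' vx].
have a0 := alpha_neq0 HA.
have la0 : lin a <> 0 by move=> /poly_of_form_eq0.
have p0 : p <> 0.
  by move=> p0; apply: nap; exists 0; rewrite p0 mul0r poly_of_form0.
(* Modulo a, this derivation sends a to q(px) - p(qx) = 0, so it lies in D(A). *)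
have [c ec] : exists c : 'I_m -> S, q *: u - lin p *: v = \sum_(i < m) c i *: b i.
  apply: b_gen; apply: logder_del; first by rewrite rpredB // rpredZ.
  rewrite der_appB !der_appZ.
  rewrite (_ : _ - _ = q * (der_app u (lin a) - lin p * x)
                       - lin p * (der_app v (lin a) - q * x)); last by ring.
  by apply: rdvdB; apply: rdvdMl.
have [cu eu] := b_gen (logder_mul uD').
have [cv ev] := b_gen (logder_mul vD').
(* Both sides are the i-th coordinate of a(qu - pv). *)
have rel i : q * cu i - lin p * cv i = lin a * c i.
  apply/eqP; rewrite -subr_eq0; apply/eqP; move: i; apply: b_free.
  by rewrite -!sumB -!sumZ -eu -ev -ec scalerBr !scalerA ![_ * lin a]mulrC subrr.
(* Modulo a, [rel] reads q cu = p cv. As p is prime and does not divide q, cu = w p; cancelling p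
   leaves cv = w q. *)
have [w ew] : exists w : 'I_m -> S, forall i,
    rdvd (lin a) (cu i - w i * lin p) /\ rdvd (lin a) (cv i - w i * q).
  apply: (@fin_all_exists _ (fun=> S) (fun i w => rdvd (lin a) (cu i - w * lin p) /\
    rdvd (lin a) (cv i - w * q))) => i.
  have : dvdmod a (lin p) (q * cu i).
    exists (cv i); rewrite [cv i * _]mulrC rel; exists (c i); exact: mulrC.
  case/(dvdmod_prime a0 nap) => // [[w [g ew]]]; exists w; split; first by exists g.
  have : rdvd (lin a) (lin p * (cv i - w * q)).
    exists (q * g - c i).
    have -> : lin p * (cv i - w * q)
        = q * (cu i - w * lin p) - (q * cu i - lin p * cv i) by ring.
    by rewrite ew rel; ring.
  by case/(form_prime a0).
have [s es] : exists s : 'I_m -> S, forall i, cu i = w i * lin p + s i * lin a.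
  apply: (@fin_all_exists _ (fun=> S) (fun i s => cu i = w i * lin p + s * lin a)) => i.
  by have [[g eg] _] := ew i; exists g; rewrite -eg addrC subrK.
have [t et] : exists t : 'I_m -> S, forall i, cv i = w i * q + t i * lin a.
  apply: (@fin_all_exists _ (fun=> S) (fun i s => cv i = w i * q + s * lin a)) => i.
  by have [_ [g eg]] := ew i; exists g; rewrite -eg addrC subrK.
pose W := \sum_(i < m) w i *: b i.
have eu' : lin p *: W = lin a *: (u - \sum_(i < m) s i *: b i).
  by rewrite scalerBr eu !sumZ sumB; apply: eq_bigr => i _; rewrite es; congr (_ *: _); ring.
have ev' : q *: W = lin a *: (v - \sum_(i < m) t i *: b i).
  by rewrite scalerBr ev !sumZ sumB; apply: eq_bigr => i _; rewrite et; congr (_ *: _); ring.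
(* By [eu'], a divides every entry of p W; it is prime and does not divide p, so it divides W. *)
have [psi epsi] : exists psi : 'rV[S]_l, W = lin a *: psi.
  have h j : exists g, W 0 j = g * lin a.
    have : rdvd (lin a) (lin p * W 0 j).
      have /rowP/(_ j) := eu'; rewrite mxE [RHS]mxE => ->; eexists; exact: mulrC.
    by case/(form_prime a0).
  have [g eg] := @fin_all_exists _ (fun=> S) (fun j g => W 0 j = g * lin a) h.
  by exists (\row_j g j); apply/rowP => j; rewrite eg !mxE mulrC.
have epu : lin p *: psi = u - \sum_(i < m) s i *: b i.
  by apply: (scale_rVI la0); rewrite -eu' epsi !scalerA mulrC.
have eqv : q *: psi = v - \sum_(i < m) t i *: b i.
  by apply: (scale_rVI la0); rewrite -ev' epsi !scalerA mulrC.
have pD' : lin p *: psi \in D' by rewrite epu rpredB // logder_sub // sum_in_D.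
have qD' : q *: psi \in D' by rewrite eqv rpredB // logder_sub // sum_in_D.
exists psi.
  (* The form of X divides both p psi(alpha X) and q psi(alpha X). If it did not divide psi(alpha
     X), it would divide p, hence be a scalar multiple of p, and also divide q, against [npq]. *)
  apply/logderP => X XA'; have XA : X \in A by move: XA'; rewrite inE => /andP[].
  have X0 := alpha_neq0 XA.
  have := proj1 (logderP _ _ _) pD' X XA'; rewrite der_appZ.
  have := proj1 (logderP _ _ _) qD' X XA'; rewrite der_appZ.
  case/(form_prime X0) => // Xq /(form_prime X0)[|//].
  case/(form_dvd X0) => r ep; case: npq.
  have r0 : r != 0 by apply/eqP => r0; apply: p0; rewrite ep r0 scale0r.
  have [g ->] := Xq; exists (g * (r^-1)%:MP); exists 0.
  by rewrite ep poly_of_formZ -mulrA mul_mpolyC scalerA mulVf // scale1r subrr mul0r.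
(* By [epu], p(psi(a) - x) is u(a) - px minus the value at a of an element of D(A); both are
   multiples of a, and p can be cancelled. *)
have : rdvd (lin a) (lin p * (der_app psi (lin a) - x)).
  rewrite mulrBr -der_appZ epu der_appB addrAC; apply: rdvdB => //.
  by have /logderP := sum_in_D s; apply.
by case/(form_prime a0).
Qed.

Lemma prod_not_dvd (ps : seq form) : (forall p, p \in ps -> ~ rdvd (lin a) (lin p)) ->
  ~ rdvd (lin a) (\prod_(p <- ps) lin p).
Proof.
have a0 := alpha_neq0 HA.
elim: ps => [_|p ps IH h].
  rewrite big_nil => -[g].
  have [v av1] := form_normalized a0.
  move=> /(congr1 (proj_form a v)) /eqP; rewrite rmorph1 rmorphM /= .
  have /(proj_form_eq0 _ av1) -> : rdvd (lin a) (lin a) by exists 1; rewrite mul1r.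
  by rewrite mulr0 oner_eq0.
rewrite big_cons => /(form_prime a0)[]; first by apply: h; rewrite mem_head.
by apply: IH => q qps; apply: h; rewrite in_cons qps orbT.
Qed.

(** Factors are dropped while the remaining product stays attained. Once no factor can go, a
    derivation attaining the product has the required property. *)
Lemma attained_principal (ps : seq form) :
  (forall p, p \in ps -> ~ rdvd (lin a) (lin p)) ->
  attained (\prod_(p <- ps) lin p) ->
  exists2 u, u \in D' & ~ rdvd (lin a) (der_app u (lin a)) /\
    forall v, v \in D' -> exists g, v - g *: u \in D.
Proof.
have [n] := ubnP (size ps); elim: n ps => // n IHn ps szps nps att.
have [[s1 [p [s2 [e att']]]]|irr] := pselect (exists s1 p s2,
    ps = s1 ++ p :: s2 /\ attained (\prod_(p <- s1 ++ s2) lin p)).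
  apply: (IHn (s1 ++ s2)) => //; first by move: szps; rewrite e !size_cat /= addnS.
  by move=> q qs; apply: nps; move: qs; rewrite e !mem_cat in_cons => /orP[]->; rewrite ?orbT.
have [u uD' ups] := att; exists u => //; split.
  move=> au; apply: (prod_not_dvd nps).
  by have := rdvdB au ups; rewrite opprB addrC subrK.
move=> v vD'.
(* Prefixes of the minimal product divide v(a) modulo a, one factor at a time. *)
have key s1 s2 : ps = s1 ++ s2 -> dvdmod a (\prod_(p <- s1) lin p) (der_app v (lin a)).
  elim/last_ind: s1 s2 => [|s1 p IH] s2 e.
    by exists (der_app v (lin a)); exists 0; rewrite big_nil mulr1 subrr mul0r.
  rewrite cat_rcons in e; have [g eg] := IH _ e.
  have [[h eh]|npg] := pselect (dvdmod a (lin p) g).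
    exists h; rewrite -cats1 big_cat big_seq1 /=.
    rewrite (_ : _ - _ = (der_app v (lin a) - g * \prod_(p <- s1) lin p)
                    + \prod_(p <- s1) lin p * (g - h * lin p)); last by ring.
    by apply: rdvdD => //; apply: rdvdMl.
  (* If p does not divide the cofactor g modulo a, take q = g and x the product without p. Then px
     is the whole product, and gx is v(a) times the product over [s2] modulo a. Both are attained,
     so x is too, and p could have been dropped. *)
  case: irr; exists s1, p, s2; split=> //.
  apply: (attained_coprime _ npg); first by apply: nps; rewrite e mem_cat in_cons eqxx orbT.
    by move: att; rewrite e !big_cat big_cons /= mulrCA.
  rewrite big_cat /= mulrA mulrC; apply: attainedM.
  by exists v.
have [g eg] := key ps [::] (esym (cats0 ps)).
exists g; apply: logder_del; first by rewrite rpredB // rpredZ.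
rewrite der_appB der_appZ.
rewrite (_ : _ - _ = (der_app v (lin a) - g * \prod_(p <- ps) lin p)
  - g * (der_app u (lin a) - \prod_(p <- ps) lin p)); last by ring.
by apply: rdvdB => //; apply: rdvdMl.
Qed.

Lemma logder_deletion :
  exists2 u, u \in D' & ~ rdvd (lin a) (der_app u (lin a)) /\
    forall v, v \in D' -> exists g, v - g *: u \in D.
Proof.
have [v av1] := form_normalized (alpha_neq0 HA).
apply: (@attained_principal [seq alpha X | X <- enum_fset (A `\ H)]).
  move=> p /mapP[X]; rewrite !inE => /andP[/eqP ne XA] ->.
  by apply: alpha_ndvd => // e; apply: ne.
pose Q := \prod_(p <- [seq alpha X | X <- enum_fset (A `\ H)]) lin p.
(* The constant derivation along v sends a to 1; multiplying it by Q makes it logarithmic along all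
   of A'. *)
exists (Q *: map_mx (@mpolyC l K) v); last first.
  by rewrite der_appZ der_app_const av1 mulr1 subrr; exists 0; rewrite mul0r.
apply/logderP => X XA'; rewrite der_appZ mulrC; apply: rdvdMl.
rewrite /Q big_map (big_rem X) //=; exists (\prod_(Y <- rem X (A `\ H)) lin (alpha Y)).
exact: mulrC.
Qed.

End FreeBasis.
End Logder.

(** * Rank bounds and finiteness of bases over a domain *)

Lemma fraction_numden (R : idomainType) (x : {fraction R}) :
  exists n d, d != 0 /\ x * FracField.tofrac d = FracField.tofrac n.
Proof.
elim/quotW: x => x; exists (frac x).1, (frac x).2; split; first exact: denom_ratioP.
rewrite /FracField.tofrac; unlock; rewrite -[LHS]FracField.pi_mul; apply/eqmodP.
rewrite /= FracField.equivfE /FracField.mulf /=.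
rewrite !numden_Ratio ?oner_eq0 ?mulr1 ?denom_ratioP //.
by rewrite mulrC.
Qed.

(** Over the fraction field, a matrix with more rows than columns has a nonzero left kernel vector;
    clearing denominators brings it back to R. *)
Lemma rV_dependent (R : idomainType) (m l : nat) (b : 'I_m -> 'rV[R]_l) : (l < m)%N ->
  exists c : 'I_m -> R, \sum_(i < m) c i *: b i = 0 /\ exists i, c i != 0.
Proof.
move=> lm.
pose N : 'M[{fraction R}]_(m, l) := \matrix_(i, j) FracField.tofrac (b i 0 j).
have : kermx N != 0.
  rewrite kermx_eq0 /row_free neq_ltn (leq_ltn_trans _ lm) //; exact: rank_leq_col.
case/rowV0Pn => v /sub_kermxP vN v0.
have [n /fin_all_exists[d nd]] := fin_all_exists (fun i => fraction_numden (v 0 i)).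
(* A common denominator [e], and the numerators of [v] over it. *)
pose e := \prod_i d i; pose c i := n i * \prod_(j | j != i) d j.
have e0 : e != 0 by apply/prodf_neq0 => i _; have [] := nd i.
have ec i : v 0 i * FracField.tofrac e = FracField.tofrac (c i).
  have [_ h] := nd i.
  by rewrite /e /c (bigD1 i) //= !tofracM mulrA h.
exists c; split.
  apply/rowP => j; rewrite summxE mxE; apply/eqP; rewrite -tofrac_eq0 raddf_sum.
  have /rowP/(_ j)/(congr1 ( *%R (FracField.tofrac e))) := vN; rewrite !mxE mulr0 => vNj.
  rewrite -[X in _ == X]vNj mulr_sumr; apply/eqP; apply: eq_bigr => i _.
  by rewrite !mxE /= tofracM -ec mulrAC mulrC [v 0 i * _]mulrC mulrCA mulrA.
have [i vi] : exists i, v 0 i != 0 by apply/rV0Pn.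
by exists i; rewrite -tofrac_eq0 -ec mulf_neq0 // tofrac_eq0.
Qed.

(** The index type of a basis may a priori be infinite. Duplicate-free lists of indices have length
    at most l by [rV_dependent], so a longest one contains every index. *)
Lemma basis_finite (R : idomainType) (M : lmodType R) (l : nat)
    (f : {linear M -> 'rV[R]_l}) (I : choiceType) (b : I -> M) :
  injective f -> is_basis b ->
  exists m (t : 'I_m -> M), [/\ (m <= l)%N,
    forall x, exists c : 'I_m -> R, x = \sum_(i < m) c i *: t i
    & forall c : 'I_m -> R, \sum_(i < m) c i *: t i = 0 -> forall i, c i = 0].
Proof.
move=> finj [bgen bfree].
have free (s : seq I) (c : 'I_(size s) -> R) : uniq s ->
    \sum_(k < size s) c k *: b (tnth (in_tuple s) k) = 0 -> forall k, c k = 0.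
  (* [c'] moves coefficients from positions in [s] to indices in [I]; the default 0 is never read on
     [s]. *)
  move=> us c0 k; pose c' x := oapp c 0 (insub (index x s)).
  have c'E i : c' (tnth (in_tuple s) i) = c i.
    by rewrite /c' (tnth_nth (tnth (in_tuple s) i)) index_uniq // valK.
  rewrite -c'E; apply: (bfree s) => //; last exact: mem_tnth.
  by rewrite big_tnth -[RHS]c0; apply: eq_bigr => i _; rewrite c'E.
have bound n : `[< exists s : seq I, uniq s /\ size s = n >] -> (n <= l)%N.
  move=> /asboolP[s [us <-]]; rewrite leqNgt; apply/negP => ls.
  have [c [c0 [k /eqP]]] := rV_dependent (fun k => f (b (tnth (in_tuple s) k))) ls.
  apply; apply: free => //; apply: finj; rewrite linear0 -[RHS]c0 linear_sum.
  by apply: eq_bigr => i _; rewrite linearZ.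
have ex0 : exists n, `[< exists s : seq I, uniq s /\ size s = n >].
  by exists 0%N; apply/asboolP; exists [::].
case: (ex_maxnP ex0 bound) => m Pm mmax.
have ml := bound _ Pm; case/asboolP: Pm => s [us sm]; subst m.
have sT i : i \in s.
  apply/negPn/negP => ins; have := mmax (size s).+1; rewrite ltnn => h.
  by apply/notF/h/asboolP; exists (i :: s); rewrite /= ins.
exists (size s), (fun k => b (tnth (in_tuple s) k)); split=> // [x|c]; last exact: free.
have [r [c ->]] := bgen x.
(* The list [r] may repeat an index, so its coefficients are added up. *)
exists (fun k => \sum_(i <- r | i == tnth (in_tuple s) k) c i).
under [RHS]eq_bigr do rewrite scaler_suml.
rewrite (exchange_big_dep xpredT) //=; apply: eq_bigr => i _.
have [k ek] : exists k, i = tnth (in_tuple s) k by apply/tnthP; rewrite /= sT.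
rewrite (bigD1 k) ?ek //= big1 ?addr0 // => k' /andP[/eqP e /eqP]; case.
move: e; rewrite !(tnth_nth i) => e; apply/val_inj/eqP.
by rewrite -(nth_uniq i _ _ us) ?ltn_ord //= -e.
Qed.

(** * Projectivity of free modules and resolutions with one relation *)

Section Projective.
Context {R : nzRingType}.

Lemma rV_projective n : projective ('rV[R]_n : lmodType R).
Proof.
move=> M N g f gsurj.
have [y ey] : exists y : 'I_n -> M, forall i, g (y i) = f (delta_mx 0 i).
  apply: (@fin_all_exists _ (fun=> M) (fun i y => g y = f (delta_mx 0 i))) => i.
  exact: gsurj.
pose h (v : 'rV[R]_n) : M := \sum_i v 0 i *: y i.
have hlin : linear h.
  move=> c u v; rewrite /h scaler_sumr -big_split; apply: eq_bigr => i _.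
  by rewrite !mxE scalerDl scalerA.
pose hL := GRing.isLinear.Build R _ _ _ h hlin.
exists (HB.pack_for {linear 'rV[R]_n -> M} h hL) => v /=.
rewrite {2}(row_sum_delta v) /h !linear_sum; apply: eq_bigr => i _.
by rewrite !linearZ /= ey.
Qed.
End Projective.

Section OneRelation.
Context {R : idomainType} {M : lmodType R} (n : nat) (t : 'I_n -> M) (w : 'rV[R]_n).
Hypothesis t_gen : forall x, exists c : 'I_n -> R, x = \sum_i c i *: t i.
Hypothesis w0 : w != 0.
Hypothesis w_rel : \sum_i w 0 i *: t i = 0.
Hypothesis t_rel : forall c : 'rV[R]_n, \sum_i c 0 i *: t i = 0 -> exists g, c = g *: w.

(** The resolution is 0 -> R -> R^n -> M -> 0, whose first map sends 1 to w. It is injective since R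
    is a domain and w is nonzero. *)
Lemma one_relation_pd : pd_le M 1.
Proof.
pose r i := match i with 0%N => n | 1%N => 1%N | _ => 0%N end.
pose P i : lmodType R := 'rV[R]_(r i).
pose B i : 'M[R]_(r i.+1, r i) := match i with 0%N => w | _ => 0 end.
pose d i : {linear P i.+1 -> P i} := mulmxr (B i).
pose e0 (c : P 0%N) : M := \sum_i c 0 i *: t i.
have elin : linear e0.
  move=> c u v; rewrite /e0 scaler_sumr -big_split; apply: eq_bigr => i _.
  by rewrite !mxE scalerDl scalerA.
pose eL := GRing.isLinear.Build R _ _ _ e0 elin.
pose e : {linear P 0%N -> M} := HB.pack_for {linear P 0%N -> M} e0 eL.
have Bw (y : P 1%N) : d 0%N y = y 0 0 *: w.
  by apply/rowP => j; rewrite !mxE big_ord1.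
exists P, d, e; split.
- by move=> i; apply: rV_projective.
- by move=> x; have [c ->] := t_gen x; exists (\row_i c i); apply: eq_bigr => i _; rewrite mxE.
- move=> x; split=> [/t_rel[g ->]|[y <-]]; first by exists (\row__ g); rewrite Bw mxE.
  rewrite Bw linearZ /= /e0 w_rel; exact: scaler0.
- case=> [|i] x; split.
  + rewrite Bw => /scale_rV_eq0[x0|/eqP]; last by rewrite (negPf w0).
    by exists 0; apply/rowP => j; rewrite ord1 x0 /= mul0mx mxE.
  + by move=> [y <-]; rewrite /= mulmx0 mul0mx.
  + by move=> _; exists 0; apply/rowP => - [].
  + by move=> _; rewrite /= mulmx0.
- by case=> [|[|i]] // _ x; apply/rowP => - [].
Qed.

End OneRelation.

(** * Generators of D(A') and their single relation *)

Theorem corollary1p6 (K : fieldType) (l : nat)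
    (A : {fset {vspace 'rV[K]_l}})
    (alpha : {vspace 'rV[K]_l} -> 'Hom('rV[K]_l, K^o))
    (H : {vspace 'rV[K]_l}) :
  arrangement A -> essential A -> defining_forms A alpha ->
  free_arrangement A alpha -> H \in A ->
  pd_le (logder (A `\ H) alpha) 1 /\
  generated_by_at_most (logder (A `\ H) alpha) l.+1.
Proof.
move=> arrA _ defA [I [b0 [b0B _]]] HA.
have [m [t [ml tgen tfree]]] :=
  basis_finite (f := val : {linear logder A alpha -> 'rV_l}) val_inj b0B.
pose b i := val (t i); pose a := poly_of_form (alpha H).
have bD i : b i \in logder_pred A alpha := valP (t i).
have bgen u : u \in logder_pred A alpha -> exists c : 'I_m -> _, u = \sum_(i < m) c i *: b i.
  move=> uD; have [c ec] := tgen (LogDer uD).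
  exists c; rewrite -[LHS]/(val (LogDer uD)) ec linear_sum.
  apply: eq_bigr => i _; exact: linearZ.
have bfree c : \sum_(i < m) c i *: b i = 0 -> forall i, c i = 0.
  move=> c0; apply: tfree; apply: val_inj; rewrite linear0 -[RHS]c0 linear_sum.
  by apply: eq_bigr => i _; rewrite [LHS]linearZ.
have [phi phiD' [aphi phiM]] := logder_deletion arrA defA HA bD bgen bfree.
have a0 : a <> 0 by move=> /poly_of_form_eq0; apply: alpha_neq0 arrA defA H HA.
have [u eu] := bgen _ (logder_mul phiD').
pose bD' i : logder (A `\ H) alpha := LogDer (logder_sub H (bD i)).
(* Index 0 carries phi and index i + 1 carries [b i]; [w] encodes the relation a phi = sum of
   [u i *: b i]. *)
pose g k := oapp bD' (LogDer phiD') (unlift ord0 k).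
pose w : 'rV[{mpoly K[l]}]_m.+1 := \row_k oapp (fun i => - u i) a (unlift ord0 k).
have val_g c : val (\sum_k c k *: g k) =
    c ord0 *: phi + \sum_(i < m) c (lift ord0 i) *: b i.
  rewrite linear_sum big_ord_recl [X in X + _]linearZ /g unlift_none /=; congr (_ + _).
  by apply: eq_bigr => i _; rewrite liftK.
have ggen x : exists c, x = \sum_k c k *: g k.
  have [r /bgen[c ec]] := phiM _ (valP x).
  exists (fun k => oapp c r (unlift ord0 k)); apply: val_inj; rewrite val_g unlift_none /=.
  rewrite -[LHS](subrK (r *: phi)) ec addrC; congr (_ + _).
  by apply: eq_bigr => i _; rewrite liftK.
split; last by exists m.+1, g.
apply: (@one_relation_pd _ _ _ g w) => //.
- by apply/eqP => /rowP/(_ ord0); rewrite !mxE unlift_none.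
- apply: val_inj; rewrite val_g mxE unlift_none /= eu -big_split big1 // => i _.
  by rewrite mxE liftK /= scaleNr subrr.
move=> c /(congr1 val); rewrite val_g => c0.
(* Evaluating the relation at a shows that a divides c_0 phi(a), since D(A) sends a into (a). As a
   is prime and does not divide phi(a), it divides c_0. *)
have [r er] : rdvd a (c 0 ord0).
  have : rdvd a (c 0 ord0 * der_app phi a).
    rewrite -der_appZ; move/eqP: c0; rewrite addr_eq0 => /eqP ->.
    have /logderP/(_ H HA) := sum_in_D bD (fun i => c 0 (lift ord0 i)).
    by rewrite -scaleN1r der_appZ; apply: rdvdMl.
  by case/(form_prime (alpha_neq0 arrA defA HA)).
(* Subtracting r w removes phi, and freeness of [b] kills the remaining coordinates. *)
exists r; apply/rowP => k; rewrite !mxE; case: unliftP => [i ->|->] //=.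
apply/eqP; rewrite -subr_eq0 mulrN opprK; apply/eqP; move: i.
apply: bfree; rewrite -[RHS]c0 er -scalerA eu scaler_sumr -big_split.
by apply: eq_bigr => i _; rewrite scalerDl scalerA addrC.
Qed.
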